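(* Let $P,P',Q,S$ be programs and $B$ a Boolean expression such that $P'\equiv_B(P,B)$ and $Q\equiv_B(P,\neg B)$. If the operational triple $\{|P'|\}\ S\ \{|P|\}$ holds, then $\{|P|\}\ \mathbf{while}\ (B)\ \mathbf{do}\ S\ \mathbf{elihw}\ \{|Q|\}$ holds.
   Context: Programs are statements of a sequential imperative language with a standard small-step operational semantics over program states. $\mathrm{behs}(P)$ is the set of pairs (initial state, final state) of finite terminating executions of $P$; $(s,u)\in\mathrm{behs}(P;Q)$ iff there is $t$ with $(s,t)\in\mathrm{behs}(P)$ and $(t,u)\in\mathrm{behs}(Q)$. For a state $s$ and Boolean expression $B$, $s(B)\in\{\mathit{tt},\mathit{ff}\}$ is the (side-effect-free) value of $B$ in $s$. The loop $\mathbf{while}\ (B)\ \mathbf{do}\ S\ \mathbf{elihw}$ started in state $s$ terminates in $s$ if $s(B)=\mathit{ff}$, and otherwise executes $S$ and then repeats the loop from the resulting state. The post-state set is $\mathrm{pst}(P)=\{t:\exists s,\ (s,t)\in\mathrm{behs}(P)\}$. The operational triple $\{|P|\}\ S\ \{|Q|\}$ means $\mathrm{pst}(P;S)\subseteq\mathrm{pst}(Q)$. For programs $P',P$ and Boolean expression $B$, $P'\equiv_B(P,B)$ means $\mathrm{pst}(P')=\mathrm{pst}(P)\cap\{s : s(B)=\mathit{tt}\}$. *)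

(* Defs.v *)
From Stdlib Require Import ZArith Relations.
Open Scope Z_scope.

Definition state := nat -> Z.

Inductive aexp : Type :=
  | ANum (n : Z)
  | AVar (x : nat)
  | APlus (a1 a2 : aexp)
  | AMinus (a1 a2 : aexp)
  | AMult (a1 a2 : aexp).

Inductive bexp : Type :=
  | BTrue
  | BFalse
  | BEq (a1 a2 : aexp)
  | BLe (a1 a2 : aexp)
  | BNot (b : bexp)
  | BAnd (b1 b2 : bexp)
  | BOr (b1 b2 : bexp).

Fixpoint aeval (s : state) (a : aexp) : Z :=
  match a with
  | ANum n => n
  | AVar x => s x
  | APlus a1 a2 => aeval s a1 + aeval s a2
  | AMinus a1 a2 => aeval s a1 - aeval s a2
  | AMult a1 a2 => aeval s a1 * aeval s a2
  end.

Fixpoint beval (s : state) (b : bexp) : bool :=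
  match b with
  | BTrue => true
  | BFalse => false
  | BEq a1 a2 => Z.eqb (aeval s a1) (aeval s a2)
  | BLe a1 a2 => Z.leb (aeval s a1) (aeval s a2)
  | BNot b => negb (beval s b)
  | BAnd b1 b2 => andb (beval s b1) (beval s b2)
  | BOr b1 b2 => orb (beval s b1) (beval s b2)
  end.

Definition update (s : state) (x : nat) (v : Z) : state :=
  fun y => if Nat.eqb y x then v else s y.

Inductive stmt : Type :=
  | Skip
  | Assign (x : nat) (a : aexp)
  | Seq (c1 c2 : stmt)
  | If (b : bexp) (c1 c2 : stmt)
  | While (b : bexp) (c : stmt).

Inductive step : stmt * state -> stmt * state -> Prop :=
  | st_assign : forall x a s,
      step (Assign x a, s) (Skip, update s x (aeval s a))
  | st_seq_skip : forall c2 s,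
      step (Seq Skip c2, s) (c2, s)
  | st_seq : forall c1 c1' c2 s s',
      step (c1, s) (c1', s') ->
      step (Seq c1 c2, s) (Seq c1' c2, s')
  | st_if_true : forall b c1 c2 s,
      beval s b = true -> step (If b c1 c2, s) (c1, s)
  | st_if_false : forall b c1 c2 s,
      beval s b = false -> step (If b c1 c2, s) (c2, s)
  | st_while_false : forall b c s,
      beval s b = false -> step (While b c, s) (Skip, s)
  | st_while_true : forall b c s,
      beval s b = true -> step (While b c, s) (Seq c (While b c), s).

Definition steps := clos_refl_trans (stmt * state) step.

Definition behs (P : stmt) (s t : state) : Prop := steps (P, s) (Skip, t).

Definition pst (P : stmt) (t : state) : Prop := exists s, behs P s t.

(* Operational triple {|P|} S {|Q|} :  pst(P;S) ⊆ pst(Q). *)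
Definition op_triple (P S Q : stmt) : Prop :=
  forall t, pst (Seq P S) t -> pst Q t.

(* P' ≡_B (P,B) :  pst(P') = pst(P) ∩ { s | s(B) = tt }. *)
Definition equiv_B (P' P : stmt) (B : bexp) : Prop :=
  forall t, pst P' t <-> (pst P t /\ beval t B = true).

(* Main.v *)
(** Call a set of states [I] an invariant of the body [S] under [B] if every
    terminating run of [S] from a state of [I] satisfying [B] ends in [I]; by
    the hypotheses, [pst P] is one.  Along a run of [c; while (B) do S elihw],
    where every terminating run of [c] ends in [I], each configuration is the
    loop at a state of [I], a residual body [c'; loop] with the same property
    as [c], or [Skip] at a state of [I] falsifying [B]: this shape is preserved
    by every small step.  Taking [c := P], a terminating run of [P; loop] ends
    in [pst P] with [B] false, i.e. in [pst Q]. *)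

Require Import Defs.
From Stdlib Require Import Relations.

Lemma steps_map (f : stmt * state -> stmt * state) :
  (forall x y, step x y -> step (f x) (f y)) ->
  forall x y, steps x y -> steps (f x) (f y).
Proof.
  intros f_step x y Hxy.
  induction Hxy as [x y Hxy | x | x y z _ IHxy _ IHyz].
  - apply rt_step, f_step, Hxy.
  - apply rt_refl.
  - apply rt_trans with (f y); assumption.
Qed.

Lemma steps_seq_left (c1 c1' c2 : stmt) (s s' : state) :
  steps (c1, s) (c1', s') -> steps (Seq c1 c2, s) (Seq c1' c2, s').
Proof.
  apply (steps_map (fun x => (Seq (fst x) c2, snd x))).
  intros [c u] [c' u'] Hstep; apply st_seq, Hstep.
Qed.

Lemma behs_seq (c1 c2 : stmt) (s m t : state) :
  behs c1 s m -> behs c2 m t -> behs (Seq c1 c2) s t.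
Proof.
  intros H1 H2.
  apply rt_trans with (Seq Skip c2, m); [now apply steps_seq_left |].
  apply rt_trans with (c2, m); [apply rt_step, st_seq_skip | exact H2].
Qed.

Section WhileInvariant.

Variables (B : bexp) (S : stmt) (I : state -> Prop).

Hypothesis body_invariant :
  forall u m, I u -> beval u B = true -> behs S u m -> I m.

Inductive loop_config : stmt * state -> Prop :=
  | loop_head u : I u -> loop_config (While B S, u)
  | loop_body c u :
      (forall m, behs c u m -> I m) -> loop_config (Seq c (While B S), u)
  | loop_exit u : I u -> beval u B = false -> loop_config (Skip, u).

Lemma loop_config_step x y : loop_config x -> step x y -> loop_config y.
Proof.
  intros Hx Hstep.
  destruct Hx as [u Iu | c u Hc | u _ _]; inversion Hstep; subst.
  - now apply loop_exit.
  - apply loop_body; intros m Hm; now apply body_invariant with u.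
  - apply loop_head, Hc, rt_refl.
  - apply loop_body; intros m Hm.
    apply Hc, rt_trans with (c1', s'); [apply rt_step |]; assumption.
Qed.

Lemma loop_config_steps x y : loop_config x -> steps x y -> loop_config y.
Proof.
  intros Hx Hxy; induction Hxy; eauto using loop_config_step.
Qed.

Lemma seq_while_invariant c s t :
  (forall m, behs c s m -> I m) ->
  behs (Seq c (While B S)) s t -> I t /\ beval t B = false.
Proof.
  intros Hc Hrun.
  assert (Hend : loop_config (Skip, t)).
  { apply loop_config_steps with (Seq c (While B S), s); [apply loop_body |]; assumption. }
  inversion Hend; split; assumption.
Qed.

End WhileInvariant.

Theorem theorem1 (P P' Q S : stmt) (B : bexp) :
  equiv_B P' P B ->
  equiv_B Q P (BNot B) ->
  op_triple P' S P ->
  op_triple P (While B S) Q.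
Proof.
  intros HP' HQ Htriple t [s Hrun].
  assert (Hinv : forall u m, pst P u -> beval u B = true -> behs S u m -> pst P m).
  { intros u m Pu Bu Hbody.
    destruct (proj2 (HP' u) (conj Pu Bu)) as [s0 Hs0].
    apply Htriple; exists s0; now apply behs_seq with u. }
  assert (HP : forall m, behs P s m -> pst P m) by (intros m Hm; now exists s).
  destruct (seq_while_invariant B S (pst P) Hinv P s t HP Hrun) as [Pt Bt].
  apply HQ; simpl; rewrite Bt; split; [exact Pt | reflexivity].
Qed.
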